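(* Let $p$ be a prime, $q=p^m$, and for $j\in\mathrm{GF}(p)$ let $B_j=\{u\in\mathrm{GF}(q):\mathrm{Tr}(u)=j\}$. Then the setwise stabiliser of $B_j$ in $\mathrm{GA}_1(q)=\{x\mapsto ax+b:a\in\mathrm{GF}(q)^*,b\in\mathrm{GF}(q)\}$ is $$G_{B_j}=\{x\mapsto ax+b:\ a\in\mathrm{GF}(p)^*,\ b\in B_{j-ja}\},$$ and $|G_{B_j}|=(p-1)p^{m-1}$.
   Context: $\mathrm{Tr}$ denotes the absolute trace from $\mathrm{GF}(p^m)$ to $\mathrm{GF}(p)$. *)

(* Defs.v *)
From mathcomp Require Import all_boot all_order all_algebra all_fingroup all_solvable all_field.

Set Implicit Arguments.
Unset Strict Implicit.
Unset Printing Implicit Defensive.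

Import GRing.Theory GroupScope.
Local Open Scope ring_scope.

Section AffineGroup.
Variable F : finFieldType.

Definition GA1_set : {set {perm F}} :=
  [set s : {perm F} |
    [exists a : F, exists b : F, (a != 0) && [forall x, s x == a * x + b]]].

Lemma GA1_group_set : group_set GA1_set.
Proof.
apply/group_setP; split=> [|s t].
  rewrite inE; apply/existsP; exists 1; apply/existsP; exists 0.
  by rewrite oner_eq0; apply/forallP=> x; rewrite perm1 mul1r addr0.
rewrite !inE => /existsP[a /existsP[b /andP[a0 /forallP sE]]].
move=> /existsP[c /existsP[d /andP[c0 /forallP tE]]].
apply/existsP; exists (c * a); apply/existsP; exists (c * b + d).
rewrite mulf_neq0 //; apply/forallP=> x.
by rewrite permM (eqP (tE _)) (eqP (sE _)) mulrDr mulrA addrA.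
Qed.

Canonical GA1 := Group GA1_group_set.

End AffineGroup.

Section AbsoluteTrace.
Variables (p : nat) (F : finFieldType) (charF : p \in [pchar F]).

(* [pPrimeCharType charF] is F viewed as a Galois extension of 'F_p; the
   trace takes its values in the image of 'F_p in F. *)
Local Notation FFp := (pPrimeCharType charF).

Definition ofFp (c : 'F_p) : F := (c%:A : FFp).

Definition Tr (u : F) : F := galTrace 1%AS {:FFp}%AS (u : FFp).

Definition B (j : 'F_p) : {set F} := [set u : F | Tr u == ofFp j].

End AbsoluteTrace.

(* Main.v *)
(* If x |-> a x + b stabilises B_j, then multiplication by a preserves the
   hyperplane Tr = 0, so Tr(a x) = c Tr(x) for some c in GF(p).  Then
   Tr((a - c) x) = 0 for all x, and a = c because the trace is not zero.  The
   p fibres of Tr are translates of each other, so each has p^(m-1) elements. *)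
Require Import Defs.
From HB Require Import structures.
From mathcomp Require Import all_boot all_order all_algebra all_fingroup all_solvable all_field.

Import GRing.Theory.
Local Open Scope ring_scope.

Section AbsoluteTraceTheory.
Variables (p : nat) (F : finFieldType) (charF : p \in [pchar F]).
Local Notation FFp := (pPrimeCharType charF).
Local Notation ofFp := (ofFp charF).
Local Notation Tr := (Tr charF).
Local Notation B := (B charF).

Fact ofFp_zmod_morphism : zmod_morphism ofFp.
Proof. by move=> c d; exact: (rmorphB (in_alg FFp)). Qed.

Fact ofFp_monoid_morphism : monoid_morphism ofFp.
Proof.
by split=> [|c d]; [exact: (rmorph1 (in_alg FFp)) | exact: (rmorphM (in_alg FFp))].
Qed.

HB.instance Definition _ :=
  GRing.isZmodMorphism.Build 'F_p F ofFp ofFp_zmod_morphism.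
HB.instance Definition _ :=
  GRing.isMonoidMorphism.Build 'F_p F ofFp ofFp_monoid_morphism.

Fact Tr_zmod_morphism : zmod_morphism Tr.
Proof. by move=> u v; exact: (raddfB (galTrace 1%AS {:FFp}%AS)). Qed.

HB.instance Definition _ := GRing.isZmodMorphism.Build F F Tr Tr_zmod_morphism.

(** Each automorphism summed in the trace is linear over ['F_p]. *)
Lemma Tr_ofFpM c u : Tr (ofFp c * u) = ofFp c * Tr u.
Proof.
have ofFpM v : ofFp c * v = (c *: (v : FFp)) by exact: (@mulr_algl _ FFp).
rewrite !ofFpM /Defs.Tr /galTrace scaler_sumr.
by apply: eq_bigr => x _; rewrite linearZ.
Qed.

Lemma Tr_ofFp u : exists c, Tr u = ofFp c.
Proof.
have /vlineP[c Dc] : Tr u \in (1%AS : {subfield FFp}).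
  by apply: mem_galTrace; rewrite ?finField_galois ?sub1v ?memvf.
by exists c.
Qed.

Lemma Tr_neq0 : exists u, Tr u != 0.
Proof.
(* Dedekind independence of the automorphisms, with all coefficients 1. *)
have [|u _ nz_u] := @gal_independent_contra 'F_p FFp {:FFp}%AS
  [in 'Gal({:FFp} / 1%AS)%g] (fun=> 1) 1%g (group1 _); first exact: oner_neq0.
exists u; congr (_ != 0): nz_u.
by apply: eq_bigr => x _; rewrite mul1r.
Qed.

(** A nonzero trace value [d] can be rescaled to any [c] by the scalar [c / d]. *)
Lemma Tr_surj c : exists u, Tr u = ofFp c.
Proof.
have [u] := Tr_neq0; have [d Du] := Tr_ofFp u; rewrite Du fmorph_eq0 => nz_d.
by exists (ofFp (c / d) * u); rewrite Tr_ofFpM Du -rmorphM divfK.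
Qed.

Lemma mem_B j u : (u \in B j) = (Tr u == ofFp j).
Proof. by rewrite inE. Qed.

Lemma affine_stabilises_B (j c : 'F_p) (b : F) : c != 0 -> b \in B (j - j * c) ->
  forall x, (ofFp c * x + b \in B j) = (x \in B j).
Proof.
move=> nz_c; rewrite !mem_B => /eqP Tr_b x.
rewrite !mem_B raddfD /= Tr_ofFpM Tr_b -subr_eq0 rmorphB rmorphM /=.
(* The difference of the two sides factors as [ofFp c * (Tr x - ofFp j)]. *)
rewrite addrCA addrC addrK [ofFp j * _]mulrC -mulrBr mulf_eq0 subr_eq0.
by rewrite fmorph_eq0 (negPf nz_c).
Qed.

Lemma B_stabiliser_coeffs (j : 'F_p) (a b : F) : a != 0 ->
    (forall x, (a * x + b \in B j) = (x \in B j)) ->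
  exists c, [/\ a = ofFp c, c != 0 & b \in B (j - j * c)].
Proof.
move=> nz_a stab.
(* [x0] is a base point of [B j]; [e] has trace 1, so the multiplier [c] can be read off as the
   trace of [a * e]. *)
have [x0 Tr_x0] := Tr_surj j; have [e Tr_e] := Tr_surj 1.
have [c Tr_ae] := Tr_ofFp (a * e).
have Tr_affine x : Tr x = ofFp j -> Tr (a * x) + Tr b = ofFp j.
  by move=> Tr_x; apply/eqP; rewrite -raddfD /= -mem_B stab mem_B Tr_x.
(* The hyperplane of trace zero elements consists of differences within B j. *)
have ker_stable h : Tr h = 0 -> Tr (a * h) = 0.
  move=> Tr_h; have := Tr_affine (h + x0); rewrite raddfD /= Tr_h add0r.
  move=> /(_ Tr_x0); rewrite -(Tr_affine x0 Tr_x0) mulrDr raddfD /= -addrA.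
  by rewrite -[RHS]add0r => /addIr.
have Tr_aM x : Tr (a * x) = ofFp c * Tr x.
  (* With [d] the trace of [x], the element [x - ofFp d * e] has trace zero, so [ker_stable] applies
     to it. *)
  have [d Tr_x] := Tr_ofFp x; apply/eqP; rewrite -subr_eq0; apply/eqP.
  rewrite -(ker_stable (x - ofFp d * e)).
    by rewrite mulrBr raddfB /= mulrCA Tr_ofFpM Tr_ae Tr_x [ofFp d * _]mulrC.
  by rewrite raddfB /= Tr_ofFpM Tr_e Tr_x rmorph1 mulr1 subrr.
have Da : a = ofFp c.
  apply/eqP; rewrite -subr_eq0; apply/negPn/negP => nz_ac.
  have [u /eqP[]] := Tr_neq0; rewrite -[u](mulVKf nz_ac) mulrBl raddfB /=.
  by rewrite Tr_aM Tr_ofFpM subrr.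
exists c; split=> //; first by rewrite -(fmorph_eq0 ofFp) /= -Da.
(* The trace of [b] is forced by evaluating the affine map at [x0]. *)
rewrite mem_B rmorphB rmorphM /= eq_sym subr_eq addrC.
by rewrite -{1}(Tr_affine x0 Tr_x0) Tr_aM Tr_x0 mulrC.
Qed.

Lemma card_B_Fp k : (p * #|B k| = #|F|)%N.
Proof.
have pr_p := pcharf_prime charF.
have card_eq c : #|B c| = #|B k|.
  (* Translation by [e] carries [B k] onto [B c]. *)
  have [e Tr_e] := Tr_surj (c - k).
  rewrite -[RHS](card_imset _ (addrI e)); apply: eq_card => u.
  rewrite mem_B; apply/eqP/imsetP => [Tr_u | [v]].
    by exists (u - e); rewrite ?subrKC // mem_B raddfB /= Tr_u Tr_e -rmorphB /= subKr.
  by rewrite mem_B => /eqP Tr_v ->; rewrite raddfD /= Tr_v Tr_e -rmorphD /= subrK.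
transitivity (\sum_(c : 'F_p) #|B c|)%N.
  by rewrite (eq_bigr _ (fun c _ => card_eq c)) sum_nat_const card_Fp.
under eq_bigr do rewrite -sum1_card.
(* Double counting: each [u] lies in exactly one fibre. *)
rewrite (exchange_big_dep predT) //= -sum1_card; apply: eq_bigr => u _.
have [c Tr_u] := Tr_ofFp u; rewrite (big_pred1 c) // => d.
by rewrite mem_B Tr_u (inj_eq (fmorph_inj ofFp)) eq_sym.
Qed.

Lemma affine_inj (a b : F) : a != 0 -> injective (fun x => a * x + b).
Proof. by move=> nz_a x y /addIr /(mulfI nz_a). Qed.

Lemma ofFp_unit_neq0 (c : {unit 'F_p}) : ofFp (val c) != 0.
Proof. by rewrite fmorph_eq0 -unitfE; exact: (valP c). Qed.

(** Parametrises the stabiliser by coefficient pairs, so that counting maps becomes counting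
    pairs. *)
Definition affine_perm (z : {unit 'F_p} * F) : {perm F} :=
  perm (@affine_inj _ z.2 (ofFp_unit_neq0 z.1)).

Lemma affine_permE z x : affine_perm z x = ofFp (val z.1) * x + z.2.
Proof. by rewrite permE. Qed.

(** The values at 0 and 1 determine both coefficients. *)
Lemma affine_perm_inj : injective affine_perm.
Proof.
move=> [c b] [d b'] Dcd.
have Db : b = b'.
  by have := affine_permE (c, b) 0; rewrite Dcd affine_permE /= !mulr0 !add0r.
have := affine_permE (c, b) 1; rewrite Dcd affine_permE /= Db.
by move/addIr; rewrite !mulr1 => /(fmorph_inj ofFp) /val_inj ->.
Qed.

End AbsoluteTraceTheory.

Theorem theorem23 (p m : nat) (F : finFieldType)
    (hp : prime p) (hq : #|F| = (p ^ m)%N) (j : 'F_p) :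
  let charF : p \in [pchar F] := card_finPcharP hq hp in
  let G_Bj : {set {perm F}} := ('N_(GA1 F)(B charF j | 'P))%g in
  G_Bj = [set s : {perm F} |
            [exists a : 'F_p, exists b : F,
              [&& a != 0, b \in B charF (j - j * a)
                & [forall x, s x == ofFp charF a * x + b]]]]
  /\ #|G_Bj| = ((p - 1) * p ^ (m - 1))%N.
Proof.
move=> charF G_Bj.
have DG : G_Bj = [set s : {perm F} |
            [exists a : 'F_p, exists b : F,
              [&& a != 0, b \in B charF (j - j * a)
                & [forall x, s x == ofFp charF a * x + b]]]].
  apply/setP => s; rewrite inE [RHS]inE; apply/andP/existsP.
    rewrite inE => -[/existsP[a /existsP[b /andP[nz_a /forallP Ds]]] /astabsP stab].
    have [|c [Da nz_c Bb]] := B_stabiliser_coeffs p F charF j a b nz_a.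
      by move=> x; rewrite -(eqP (Ds x)); exact: stab.
    exists c; apply/existsP; exists b; rewrite nz_c Bb.
    by apply/forallP => x; rewrite -Da.
  case=> c /existsP[b /and3P[nz_c Bb /forallP Ds]]; split.
    rewrite inE; apply/existsP; exists (ofFp charF c); apply/existsP; exists b.
    by rewrite fmorph_eq0 nz_c; apply/forallP.
  apply/astabsP => x; rewrite /= apermE (eqP (Ds x)).
  exact: affine_stabilises_B.
split=> //; rewrite {}DG.
(* Over each unit [c], the fibre of [A] is a trace class. *)
pose A := [set z : {unit 'F_p} * F | z.2 \in B charF (j - j * val z.1)].
transitivity #|affine_perm p F charF @: A|.
  apply: eq_card => s; rewrite inE; apply/existsP/imsetP.
    case=> c /existsP[b /and3P[nz_c Bb /forallP Ds]].
    have Uc : c \is a GRing.unit by rewrite unitfE.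
    exists (FinRing.unit 'F_p Uc, b); first by rewrite inE.
    by apply/permP => x; rewrite affine_permE (eqP (Ds x)).
  case=> -[c b]; rewrite inE /= => Bb ->; exists (val c).
  apply/existsP; exists b; rewrite Bb -unitfE (valP c) /=.
  by apply/forallP => x; rewrite affine_permE.
rewrite (card_imset _ (affine_perm_inj p F charF)).
have p_gt0 := prime_gt0 hp.
have card_B k : #|B charF k| = (p ^ (m - 1))%N.
  (* Subtraction in [m - 1] is truncated; [m = 0] would give a field with one element. *)
  have m_gt0 : (0 < m)%N.
    by case: (posnP m) => // m0; have := finNzRing_gt1 F; rewrite hq m0.
  apply/eqP; rewrite -(eqn_pmul2l p_gt0) card_B_Fp hq.
  by rewrite -expnS subn1 prednK.
rewrite -sum1_card.
transitivity (\sum_(c : {unit 'F_p}) \sum_(b in B charF (j - j * val c)%R) 1)%N.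
  by rewrite pair_big_dep /=; apply: eq_bigl => -[c b]; rewrite inE.
under eq_bigr do rewrite sum1_card card_B.
by rewrite sum_nat_const -cardsT card_finField_unit card_Fp // !subn1.
Qed.
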